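(* Let $\kappa>0$, fix $\rho_0,\rho_1\in\mathcal P^{\oplus}(\bar\Omega)$, and assume that $\mu=(\omega,F;\gamma,G,f)\in\mathcal{CE}(\rho_0,\rho_1)$ is such that $\mathcal A(\mu)<\infty$ and, for some $(\phi,\psi)\in\mathcal C^1(Q_{\bar\Omega})\times\mathcal C^1(Q_\Gamma)$, $$F=\omega\nabla\phi,\qquad G=\gamma\nabla\psi,\qquad f=\gamma\,\frac{\psi-\phi|_{\partial\Omega}}{\kappa^2},$$ as well as $$\partial_t\phi+\tfrac12|\nabla\phi|^2\le0\ \text{ everywhere in }Q_{\bar\Omega},\ \text{with equality }\omega\text{-a.e.},$$ $$\partial_t\psi+\tfrac12|\nabla\psi|^2+\tfrac1{2\kappa^2}|\psi-\phi|^2\le0\ \text{ everywhere in }Q_\Gamma,\ \text{with equality }\gamma\text{-a.e.}$$ Then $\mu$ is a minimizer for $\mathcal W_\kappa^2(\rho_0,\rho_1)$, i.e. $\mathcal W_\kappa^2(\rho_0,\rho_1)=\mathcal A(\mu)$.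
   Context: Setting: $\Omega\subset\mathbb R^d$ is a smooth bounded domain; $\Gamma:=\partial\Omega$ is viewed as a smooth $(d-1)$-dimensional manifold without boundary, and $\nabla$ applied to functions on $\Gamma$ is the intrinsic (tangential) gradient. $Q_{\bar\Omega}:=[0,1]\times\bar\Omega$, $Q_\Gamma:=[0,1]\times\Gamma$. $\mathcal M(X)$, $\mathcal M^+(X)$, $\mathcal P(X)$ are the finite signed Borel measures, nonnegative measures, probability measures on $X$; $\mathcal M(Q_{\bar\Omega})^d$ and $\mathcal M(Q_\Gamma)^{d-1}$ denote vector measures (tangential to $\Gamma$ in the second case). Measures on $\Gamma$ are also regarded as measures on $\bar\Omega$ supported on $\partial\Omega$. $\mathcal P^{\oplus}(\bar\Omega):=\{(\omega,\gamma)\in\mathcal M^+(\bar\Omega)\times\mathcal M^+(\Gamma):\ \omega+\gamma\in\mathcal P(\bar\Omega)\}$. Continuity equations: for $\rho_i=(\omega_i,\gamma_i)$, $\mathcal{CE}(\rho_0,\rho_1)$ is the set of $\mu=(\omega,F;\gamma,G,f)\in\mathcal M(Q_{\bar\Omega})\times\mathcal M(Q_{\bar\Omega})^d\times\mathcal M(Q_\Gamma)\times\mathcal M(Q_\Gamma)^{d-1}\times\mathcal M(Q_\Gamma)$ such that, for all $\varphi\in\mathcal C^1(Q_{\bar\Omega})$ and $\psi\in\mathcal C^1(Q_\Gamma)$, $$\iint_{Q_{\bar\Omega}}\partial_t\varphi\,d\omega+\iint_{Q_{\bar\Omega}}\nabla\varphi\cdot dF-\iint_{Q_\Gamma}\varphi\,df=\int_{\bar\Omega}\varphi(1,\cdot)\,d\omega_1-\int_{\bar\Omega}\varphi(0,\cdot)\,d\omega_0,$$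 $$\iint_{Q_\Gamma}\partial_t\psi\,d\gamma+\iint_{Q_\Gamma}\nabla\psi\cdot dG+\iint_{Q_\Gamma}\psi\,df=\int_\Gamma\psi(1,\cdot)\,d\gamma_1-\int_\Gamma\psi(0,\cdot)\,d\gamma_0.$$ Action: $A_\Omega(\omega,F)=\frac{|F|^2}{2\omega}$ if $\omega>0$, $0$ if $(\omega,F)=(0,0)$, $+\infty$ otherwise, on $\mathbb R\times\mathbb R^d$; $A^\kappa_\Gamma(\gamma,G,f)=\frac{|G|^2+\kappa^2f^2}{2\gamma}$ if $\gamma>0$, $0$ if $(\gamma,G,f)=(0,0,0)$, $+\infty$ otherwise, on $\mathbb R\times\mathbb R^{d-1}\times\mathbb R$. For $\mu=(\mu_\Omega,\mu_\Gamma)$ with $\mu_\Omega=(\omega,F)$, $\mu_\Gamma=(\gamma,G,f)$, $$\mathcal A(\mu):=\iint_{Q_{\bar\Omega}}A_\Omega\Big(\tfrac{d\mu_\Omega}{d\lambda_\Omega}\Big)d\lambda_\Omega+\iint_{Q_\Gamma}A^\kappa_\Gamma\Big(\tfrac{d\mu_\Gamma}{d\lambda_\Gamma}\Big)d\lambda_\Gamma$$ for any nonnegative measures $\lambda_\Omega,\lambda_\Gamma$ with $|\mu_\Omega|\ll\lambda_\Omega$, $|\mu_\Gamma|\ll\lambda_\Gamma$ (independent of the choice by $1$-homogeneity). Finally $\mathcal W_\kappa^2(\rho_0,\rho_1):=\inf_{\mu\in\mathcal{CE}(\rho_0,\rho_1)}\mathcal A(\mu)$. *)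

(* Defs.v *)
From HB Require Import structures.
From mathcomp Require Import all_boot all_order all_algebra.
From mathcomp Require Import all_classical all_reals all_analysis.
Set Implicit Arguments.
Unset Strict Implicit.
Unset Printing Implicit Defensive.
Import Order.TTheory GRing.Theory Num.Theory.
Import numFieldNormedType.Exports.
Local Open Scope classical_set_scope.
Local Open Scope ring_scope.

Notation borel T := (g_sigma_algebraType (@open T)).

Section signed_measures.
Context d (T : measurableType d) (R : realType).
Implicit Types (nu : {charge set T -> \bar R}) (X D : set T).

Definition hahn_pos nu : set T := sval (cid (Hahn_decomposition nu)).

Definition hahn_neg nu : set T :=
  sval (cid (svalP (cid (Hahn_decomposition nu)))).

Lemma hahn_posneg nu : hahn_decomposition nu (hahn_pos nu) (hahn_neg nu).
Proof. exact: svalP (cid (svalP (cid (Hahn_decomposition nu)))). Qed.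

Definition tvariation nu : {measure set T -> \bar R} :=
  charge_variation (hahn_posneg nu).

Definition cintegral nu D (g : T -> R) : R :=
  \int[jordan_pos (hahn_posneg nu)]_(x in D) g x -
  \int[jordan_neg (hahn_posneg nu)]_(x in D) g x.

(* A measure on a subset X of T is represented by a measure on T that is
   concentrated on X. *)
Definition concentrated (m : set T -> \bar R) X :=
  forall A, measurable A -> A `&` X = set0 -> m A = 0%E.

(* nu = g . m, for measures m and nu on X *)
Definition has_density (m : {charge set T -> \bar R}) X (g : T -> R) nu :=
  forall A, measurable A -> nu A = (cintegral m (A `&` X) g)%:E.

Definition sum_variation (s : seq (charge T R)) (A : set T) :
  \bar R := (\sum_(nu <- s) tvariation nu A)%E.

End signed_measures.

Section sum_variation_measure.
Context d (T : measurableType d) (R : realType).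
Variable s : seq (charge T R).
Local Open Scope ereal_scope.

Let sv0 : sum_variation s set0 = 0.
Proof. by rewrite /sum_variation big1// => nu _; rewrite measure0. Qed.

Let sv_ge0 A : 0 <= sum_variation s A.
Proof. by apply: sume_ge0 => nu _; exact: measure_ge0. Qed.

Let sv_sigma_additive : semi_sigma_additive (sum_variation s).
Proof.
move=> F mF tF mUF; rewrite [X in X @ _](_ : _ =
  (fun n => \sum_(nu <- s) \sum_(0 <= i < n) tvariation nu (F i))); last first.
  by apply/funext => n; rewrite exchange_big.
rewrite /sum_variation; elim: s => [|nu t IH].
  rewrite big_nil (_ : (fun _ => _) = cst 0); first exact: cvg_cst.
  by apply/funext => n; rewrite big_nil.
rewrite big_cons.
rewrite (_ : (fun _ => _) = (fun n => \sum_(0 <= i < n) tvariation nu (F i) +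
  \sum_(nu <- t) \sum_(0 <= i < n) tvariation nu (F i))); last first.
  by apply/funext => n; rewrite big_cons.
apply: cvgeD => //; last exact: measure_semi_sigma_additive.
by rewrite ge0_adde_def// inE ?measure_ge0//; apply: sume_ge0.
Qed.

HB.instance Definition _ := isMeasure.Build _ _ _ (sum_variation s)
  sv0 sv_ge0 sv_sigma_additive.

Let sv_fin : fin_num_fun (sum_variation s).
Proof.
move=> A mA; rewrite /sum_variation; elim: s => [|nu t IH].
  by rewrite big_nil.
rewrite big_cons fin_numD IH andbT.
exact: (@fin_num_measure _ _ _ (charge_variation (hahn_posneg nu))).
Qed.

HB.instance Definition _ :=
  @Measure_isFinite.Build _ _ _ (sum_variation s) sv_fin.

End sum_variation_measure.

Section geometry.
Context (R : realType) (d : nat).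
Local Notation E := 'rV[R]_d.
Implicit Types (Om : set E) (x : E) (r : E -> R).

(* Euclidean structure: the library norm of 'rV_d is the maximum norm *)
Definition dot (u v : E) : R := \sum_i u 0 i * v 0 i.

Definition normsq (v : E) : R := dot v v.

Fixpoint iter_partial (s : seq 'I_d) r : E -> R :=
  if s is i :: s' then 'D_(delta_mx 0 i) (iter_partial s' r) else r.

Definition smooth r := forall s,
  continuous (iter_partial s r) /\
  forall x i, derivable (iter_partial s r) x (delta_mx 0 i).

(* near the boundary point x, Om = {r < 0} with dr(x) <> 0 *)
Definition local_defining Om x r :=
  [/\ smooth r, exists v, 'D_v r x != 0 & \forall y \near x, Om y <-> r y < 0].

Definition bdry Om : set E := closure Om `\` interior Om.

Definition smooth_bounded_domain Om :=
  [/\ Om !=set0, open Om, connected Om, bounded_set Om &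
      forall x, bdry Om x -> exists r, local_defining Om x r].

(* T_x Gamma, the kernel of the differential of any local defining function *)
Definition tangent Om x : set E :=
  [set v | exists r, local_defining Om x r /\ 'D_v r x = 0].

Definition QOm Om : set (R * E) := `[0, 1] `*` closure Om.

Definition QGa Om : set (R * E) := `[0, 1] `*` bdry Om.

Definition stdot (a b : R * E) : R := a.1 * b.1 + dot a.2 b.2.

(* v is the gradient at p of the restriction of g to X, where V p is the tangent
   space of X at p; values of g outside X are irrelevant. For a smooth domain,
   such a v is unique both on QOm Om (V full: usual space-time gradient, with
   continuous extension up to the boundary in the C^1 case) and on QGa Om
   (V p = R x T_x Gamma: time derivative and intrinsic gradient). *)
Definition is_gradient (X : set (R * E)) (V : R * E -> set (R * E))
    (g : R * E -> R) (p v : R * E) : Prop :=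
  let F := within X (nbhs p) in
  V p v /\ (fun q => g q - g p - stdot v (q - p)) =o_F (fun q => q - p).

Definition gradient X V g (p : R * E) : R * E :=
  xget 0 [set v | is_gradient X V g p v].

Definition C1 X V (g : R * E -> R) :=
  (forall p, X p -> exists v, is_gradient X V g p v) /\
  {within X, continuous (gradient X V g)}.

Definition VOm (p : R * E) : set (R * E) := setT.

Definition VGa Om (p : R * E) : set (R * E) := [set v | tangent Om p.2 v.2].

(* C^1 on [0,1] x closure Om, with one-sided derivatives on the boundary *)
Definition C1_Om Om := C1 (QOm Om) VOm.

Definition dt_Om Om g p : R := (gradient (QOm Om) VOm g p).1.

Definition grad_Om Om g p : E := (gradient (QOm Om) VOm g p).2.

(* C^1 on [0,1] x Gamma, with tangential gradient *)
Definition C1_Ga Om := C1 (QGa Om) (VGa Om).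

Definition dt_Ga Om g p : R := (gradient (QGa Om) (VGa Om) g p).1.

Definition grad_Ga Om g p : E := (gradient (QGa Om) (VGa Om) g p).2.

End geometry.

Section transport.
Context (R : realType) (d : nat).
Local Notation E := 'rV[R]_d.
Local Notation stcharge := (charge (borel (R * E)%type) R).
Local Notation smeasure := (FiniteMeasure.type (borel E) R).
Implicit Types (Om : set E) (rho : (smeasure * smeasure)%type).

Definition P_oplus Om rho :=
  [/\ concentrated rho.1 (closure Om), concentrated rho.2 (bdry Om) &
      (rho.1 setT + rho.2 setT = 1)%E].

(* F and G are given by their components in R^d; G is constrained to be tangential
   to Gamma in is_flux. *)
Record flux := Flux {
  omega_ : stcharge ;
  F_ : 'I_d -> stcharge ;
  gamma_ : stcharge ;
  G_ : 'I_d -> stcharge ;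
  f_ : stcharge }.

Definition rn_density (nu : stcharge)
    (lam : {sigma_finite_measure set borel (R * E)%type -> \bar R})
    (p : R * E) : R :=
  fine (Radon_Nikodym nu lam p).

Definition rn_vdensity (nu : 'I_d -> stcharge)
    (lam : {sigma_finite_measure set borel (R * E)%type -> \bar R})
    (p : R * E) : E :=
  \row_i rn_density (nu i) lam p.

(* the polar density of G lies in T_x Gamma, |G|-a.e. *)
Definition tangential Om (G : 'I_d -> stcharge) :=
  {ae sum_variation (codom G), forall p, QGa Om p ->
    tangent Om p.2 (rn_vdensity G (sum_variation (codom G)) p)}.

Definition is_flux Om (mu : flux) :=
  [/\ concentrated (omega_ mu) (QOm Om),
      forall i, concentrated (F_ mu i) (QOm Om),
      concentrated (gamma_ mu) (QGa Om),
      (forall i, concentrated (G_ mu i) (QGa Om)) /\ tangential Om (G_ mu) &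
      concentrated (f_ mu) (QGa Om)].

Definition CE Om rho0 rho1 : set flux := [set mu |
  [/\ is_flux Om mu,
  forall phi, C1_Om Om phi ->
    cintegral (omega_ mu) (QOm Om) (dt_Om Om phi)
    + \sum_i cintegral (F_ mu i) (QOm Om) (fun p => grad_Om Om phi p 0 i)
    - cintegral (f_ mu) (QGa Om) phi
    = \int[rho1.1]_(x in closure Om) phi (1, x)
      - \int[rho0.1]_(x in closure Om) phi (0, x) &
  forall psi, C1_Ga Om psi ->
    cintegral (gamma_ mu) (QGa Om) (dt_Ga Om psi)
    + \sum_i cintegral (G_ mu i) (QGa Om) (fun p => grad_Ga Om psi p 0 i)
    + cintegral (f_ mu) (QGa Om) psi
    = \int[rho1.2]_(x in bdry Om) psi (1, x)
      - \int[rho0.2]_(x in bdry Om) psi (0, x)]].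

Definition A_Om (w : R) (F : E) : \bar R :=
  if 0 < w then (normsq F / (2 * w))%:E
  else if (w == 0) && (F == 0) then 0%E else +oo%E.

Definition A_Ga (kappa g : R) (G : E) (f : R) : \bar R :=
  if 0 < g then ((normsq G + kappa ^+ 2 * f ^+ 2) / (2 * g))%:E
  else if [&& g == 0, G == 0 & f == 0] then 0%E else +oo%E.

Definition kinetic_action_wrt Om kappa
    (lamO lamG : {sigma_finite_measure set borel (R * E)%type -> \bar R})
    (mu : flux) : \bar R :=
  (\int[lamO]_(p in QOm Om)
     A_Om (rn_density (omega_ mu) lamO p) (rn_vdensity (F_ mu) lamO p)
   + \int[lamG]_(p in QGa Om)
     A_Ga kappa (rn_density (gamma_ mu) lamG p) (rn_vdensity (G_ mu) lamG p)
       (rn_density (f_ mu) lamG p))%E.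

(* By 1-homogeneity of A_Om and A_Ga the action does not depend on the dominating
   measures; they are taken to be the sums of the variations of the components
   of (omega, F) and of (gamma, G, f). *)
Definition kinetic_action Om kappa (mu : flux) : \bar R :=
  kinetic_action_wrt Om kappa
    (sum_variation (omega_ mu :: codom (F_ mu)))
    (sum_variation (gamma_ mu :: f_ mu :: codom (G_ mu)))
    mu.

Definition W2 Om kappa rho0 rho1 : \bar R :=
  ereal_inf [set kinetic_action Om kappa mu | mu in CE Om rho0 rho1].

End transport.

(* Main.v *)
Require Import Defs.
From mathcomp Require Import all_boot all_order all_algebra.
From mathcomp Require Import all_classical all_reals all_analysis.
From mathcomp Require Import measurable_realfun ring lra.
Set Implicit Arguments.
Unset Strict Implicit.
Unset Printing Implicit Defensive.
Import Order.TTheory GRing.Theory Num.Theory.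
Import numFieldNormedType.Exports.
Local Open Scope classical_set_scope.
Local Open Scope ring_scope.

(** The proof is the weak half of a convex duality, tested on one dual
    certificate: the pair (phi, psi).

    Adding the two continuity equations, tested against phi and psi, shows that
    the pairing
      int dt phi d omega + int grad phi . dF
      + int dt psi d gamma + int grad psi . dG + int (psi - phi) df
    takes the same value [dual_value] on every competitor, namely the boundary
    terms at times 0 and 1 (lemma [CE_dual_value]). The exchange flux f enters
    the two equations with opposite signs, which is why it is paired with the
    jump psi - phi.

    Against a dominating measure, the integrand of this pairing is
    a w + b . F + c f, where w, F, f are the densities of the competitor and
    a, b, c come from phi and psi. The Hamilton-Jacobi inequality bounds a by
    - |b|^2 / 2 - c^2 / (2 kappa^2), and completing the squares yields
      a w + b . F + c f <= (|F|^2 + kappa^2 f^2) / (2 w)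
    (lemma [pairing_le_A_Ga]). Hence every competitor has action at least
    [dual_value] (lemma [dual_value_le_action]).

    Equality holds where the squares vanish, that is for F = w b and
    f = w c / kappa^2, and where the Hamilton-Jacobi inequality is an equality
    or w = 0 (lemma [pairing_eq_A_Ga]). These are the hypotheses on mu, so its
    action is exactly [dual_value] (lemma [dual_value_eq_action]). Finiteness of
    the action serves only to exclude a negative density w.

    The rest is measure theory: integrals against signed measures become
    integrals of densities (lemma [cintegral_density]), and functions of class
    C^1 on the compact space-time sets are bounded and Borel with their
    gradients, so that all pairings are integrable. *)

(** * Densities of signed measures *)

Section charge_density.
Context (dd : measure_display) (T : measurableType dd) (R : realType).
Implicit Types (nu : {charge set T -> \bar R}) (D : set T).
Implicit Types lam : {finite_measure set T -> \bar R}.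

Lemma dominates_variation nu (lam : {measure set T -> \bar R}) :
  (forall A, measurable A -> (tvariation nu A <= lam A)%E) -> nu `<< lam.
Proof.
move=> nulam; apply/null_content_dominatesP => A mA lamA0.
apply/eqP; rewrite -abse_eq0 eq_le abse_ge0 andbT -lamA0.
exact: le_trans (abse_charge_variation (hahn_posneg nu) mA) (nulam A mA).
Qed.

Lemma sum_variation_head nu (s : seq (charge T R)) :
  nu `<< sum_variation (nu :: s).
Proof.
apply: dominates_variation => A _.
by rewrite /= /sum_variation big_cons leeDl// sume_ge0.
Qed.

Lemma sum_variation_behead nu nu' (s : seq (charge T R)) :
  nu `<< sum_variation s -> nu `<< sum_variation (nu' :: s).
Proof.
move=> /null_content_dominatesP h; apply/null_content_dominatesP => A mA.
rewrite /= /sum_variation big_cons => /eqP.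
rewrite padde_eq0 ?measure_ge0 ?sume_ge0// => /andP[_ /eqP]; exact: h.
Qed.

Lemma sum_variation_codom (I : finType) (nu : I -> charge T R) i :
  nu i `<< sum_variation (codom nu).
Proof.
apply: dominates_variation => A _.
rewrite /= /sum_variation codomE big_map big_enum /= (bigD1 i)//=.
by rewrite leeDl// sume_ge0.
Qed.

(** [rn_density] over an arbitrary measurable space. *)
Definition density nu (lam : {sigma_finite_measure set T -> \bar R})
    (x : T) : R :=
  fine (Radon_Nikodym nu lam x).

Lemma densityE nu lam x : nu `<< lam ->
  (density nu lam x)%:E = Radon_Nikodym nu lam x.
Proof. by move=> nulam; rewrite fineK// Radon_Nikodym_fin_num. Qed.

Lemma integrable_density nu lam D : nu `<< lam -> measurable D ->
  lam.-integrable D (EFin \o density nu lam).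
Proof.
move=> nulam mD; apply: (integrableS measurableT) => //.
apply: eq_integrable (Radon_Nikodym_integrable nulam) => // x _.
by rewrite /= densityE.
Qed.

Lemma measurable_density nu lam D : nu `<< lam -> measurable D ->
  measurable_fun D (density nu lam).
Proof.
move=> nulam mD; apply/measurable_EFinP.
exact: measurable_int (integrable_density nulam mD).
Qed.

Lemma charge_integral_density nu lam A : nu `<< lam -> measurable A ->
  nu A = (\int[lam]_(x in A) (density nu lam x)%:E)%E.
Proof.
move=> nulam mA; rewrite (Radon_Nikodym_integral nulam mA).
by apply: eq_integral => x _; rewrite densityE.
Qed.

Lemma integrable_mul_density nu lam D (g : T -> R) :
  nu `<< lam -> measurable D -> measurable_fun D g -> [bounded g x | x in D] ->
  lam.-integrable D (EFin \o (fun x => g x * density nu lam x)).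
Proof.
move=> nulam mD mg bg.
have := integrableMr mD mg bg (integrable_density nulam mD).
by apply: eq_integrable => // x _; rewrite /= EFinM.
Qed.

(** [cintegral] integrates against the two Jordan parts of nu, each of which has
    a density; the difference of these densities is that of nu, since both have
    the same integral over every measurable set. *)
Lemma cintegral_density nu lam D (g : T -> R) :
  nu `<< lam -> measurable D -> measurable_fun D g -> [bounded g x | x in D] ->
  cintegral nu D g = \int[lam]_(x in D) (g x * density nu lam x).
Proof.
move=> nulam mD mg bg.
set P := jordan_pos (hahn_posneg nu); set N := jordan_neg (hahn_posneg nu).
have Plam : P `<< lam by exact: jordan_pos_dominates.
have Nlam : N `<< lam by exact: jordan_neg_dominates.
have int_jordan (m : {finite_measure set T -> \bar R}) : m `<< lam ->
    let m' := charge_of_finite_measure m in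
    \int[m]_(x in D) g x = \int[lam]_(x in D) (g x * density m' lam x).
  move=> mlam m'.
  have m'lam : m' `<< lam by [].
  rewrite /Rintegral -(Radon_Nikodym_change_of_variables mlam)//.
    congr fine; apply: eq_integral => x _.
    by rewrite EFinM densityE.
  apply: measurable_bounded_integrable => //.
  by rewrite -ge0_fin_numE// fin_num_measure.
rewrite /cintegral !int_jordan// -RintegralB//; last 2 first.
- exact: integrable_mul_density.
- exact: integrable_mul_density.
have Pc : charge_of_finite_measure P `<< lam by [].
have Nc : charge_of_finite_measure N `<< lam by [].
rewrite /Rintegral; congr fine; apply: ae_eq_integral => //.
- apply/measurable_EFinP/measurable_funB; apply: measurable_funM => //;
    exact: measurable_density.
- by apply/measurable_EFinP/measurable_funM => //; exact: measurable_density.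
suff : ae_eq lam D (EFin \o (density (charge_of_finite_measure P) lam \-
    density (charge_of_finite_measure N) lam)) (EFin \o density nu lam).
  apply: filterS => x /= + Dx => /(_ Dx) [<-].
  by rewrite mulrBr.
apply: integral_ae_eq => //.
- have := integrableB mD (integrable_density Pc mD) (integrable_density Nc mD).
  by apply: eq_integrable.
- exact/measurable_EFinP/measurable_density.
move=> A AD mA.
rewrite -charge_integral_density//.
under eq_integral do rewrite /= EFinB.
rewrite integralB//; [|exact: integrable_density..].
rewrite -!charge_integral_density//.
by rewrite (jordan_decomp (hahn_posneg nu) mA) /cadd/= cscaleN1.
Qed.

(** A prescribed density with respect to nu multiplies the density of nu with
    respect to lam: densities are unique almost everywhere. *)
Lemma density_of_has_density nu nu' lam D (g : T -> R) :
  nu `<< lam -> nu' `<< lam -> measurable D -> measurable_fun D g ->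
  [bounded g x | x in D] -> has_density nu D g nu' ->
  {ae lam, forall x, D x -> density nu' lam x = g x * density nu lam x}.
Proof.
move=> nulam nu'lam mD mg bg nu'E.
suff : ae_eq lam D (EFin \o density nu' lam)
    (EFin \o (fun x => g x * density nu lam x)).
  by apply: filterS => x /= + Dx => /(_ Dx) [].
apply: integral_ae_eq => //; first exact: integrable_density.
  by apply/measurable_EFinP/measurable_funM => //; exact: measurable_density.
move=> A AD mA; rewrite -charge_integral_density// nu'E// (setIidl AD).
have mgA : measurable_fun A g by exact: measurable_funS mg.
have bgA : [bounded g x | x in A].
  case: bg => M [Mr Mg]; exists M; split => // x /Mg h y /AD; exact: h.
rewrite (cintegral_density nulam)// /Rintegral fineK//.
exact/integrable_fin_num/integrable_mul_density.
Qed.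

(** A property that holds nu-almost everywhere can fail on a set that lam
    charges, but then the density of nu vanishes lam-almost everywhere there. *)
Lemma density_variation_ae nu lam (Q : T -> Prop) : nu `<< lam ->
  {ae tvariation nu, forall x, Q x} ->
  {ae lam, forall x, Q x \/ density nu lam x = 0}.
Proof.
move=> nulam [N [mN N0 subN]].
have : ae_eq lam N (EFin \o density nu lam) (cst 0%E).
  apply: integral_ae_eq => //; first exact: integrable_density.
  move=> A AN mA; rewrite -charge_integral_density// integral0.
  apply/eqP; rewrite -abse_eq0 eq_le abse_ge0 andbT.
  rewrite (le_trans (abse_charge_variation (hahn_posneg nu) mA))//.
  by rewrite -N0 le_measure// inE.
apply: filterS => x /= h.
have [Qx|nQx] := pselect (Q x); [by left|right].
by have [] := h (subN x nQx).
Qed.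

End charge_density.

(** * Regularity of C^1 functions on space-time *)

Section continuity.
Context (R : realType).

Lemma closed_measurable_borel (U : normedModType R) (A : set U) :
  closed A -> measurable (A : set (borel U)).
Proof.
move=> cA; rewrite -(setCK A); apply: measurableC.
by apply: sub_sigma_algebra; exact: closed_openC.
Qed.

Lemma within_continuous_measurable (U : normedModType R) (D : set U)
    (f : U -> R) : closed D -> {within D, continuous f} ->
  measurable_fun (D : set (borel U)) f.
Proof.
move=> cD /continuousP cf.
apply: (measurability _ (RGenOpens.measurableE R)) => _ [_ [a [b ->] <-]].
have /open_subspaceP[V oV VD] :=
  cf _ (interval_open (a:=BRight a) (b:=BLeft b) isT isT).
rewrite setIC -VD; apply: measurableI; last exact: closed_measurable_borel.
exact: sub_sigma_algebra.
Qed.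

Lemma within_continuous_bounded (U : topologicalType) (D : set U) (f : U -> R) :
  compact D -> {within D, continuous f} -> [bounded f x | x in D].
Proof.
move=> cD cf.
have [M [Mr MfD]] := compact_bounded (continuous_compact cf cD).
by exists M; split => // x Mx y Dy; apply: (MfD x Mx); exists y.
Qed.

Lemma within_continuous_compr (U V W : topologicalType) (D : set U) (f : U -> V)
    (g : V -> W) : {within D, continuous f} -> continuous g ->
  {within D, continuous (g \o f)}.
Proof.
move=> cf cg x.
exact: (@continuous_comp (subspace D) V W f g x (cf x) (cg _)).
Qed.

End continuity.

Section C1.
Context (R : realType) (d : nat).
Local Notation E := 'rV[R]_d.
Implicit Types (X : set (R * E)) (V : R * E -> set (R * E)) (g : R * E -> R).

Lemma continuous_stdot (v : R * E) : continuous (stdot v).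
Proof.
move=> q; apply: (@continuousD _ _ _ (fun q => v.1 * q.1)
  (fun q => dot v.2 q.2)) => /=.
  by apply: cvgMl_tmp; exact: cvg_fst.
rewrite /dot; apply: continuous_big => [|i _ p]; first exact: add_continuous.
apply: cvgMl_tmp.
apply: (@continuous_comp _ _ _ snd (fun u : E => u 0 i)); first exact: cvg_snd.
exact: coord_continuous.
Qed.

Lemma is_gradient_cvg X V g p v : is_gradient X V g p v ->
  g q @[q --> within X (nbhs p)] --> g p.
Proof.
move=> [_ /eqoP gv].
have qp : (q - p) @[q --> within X (nbhs p)] --> (0 : R * E).
  rewrite -(subrr p); apply: cvgB; last exact: cvg_cst.
  by apply: cvg_within_filter; exact: cvg_id.
have vqp : stdot v (q - p) @[q --> within X (nbhs p)] --> (0 : R).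
  have -> : 0 = stdot v 0.
    by rewrite /stdot /dot big1 ?mulr0 ?addr0// => i _; rewrite mxE mulr0.
  by apply: cvg_comp; [exact: qp|exact: continuous_stdot].
have rem : (g q - g p - stdot v (q - p)) @[q --> within X (nbhs p)] --> (0 : R).
  apply/cvgr0Pnorm_le => e e0.
  have /cvgr0Pnorm_le/(_ _ e0) qe := qp.
  have := gv 1 ltr01; apply: filterS2 qe => q qe; rewrite mul1r => h.
  exact: le_trans h qe.
have gp : (fun=> g p) @ within X (nbhs p) --> g p by exact: cvg_cst.
(* g is the first-order remainder, plus the linear part, plus a constant *)
have gE : g = (fun q => g q - g p - stdot v (q - p) + stdot v (q - p) + g p).
  by apply/funext => q; rewrite !subrK.
rewrite [X in X @ _]gE -[X in _ --> X]add0r; apply: cvgD gp.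
by rewrite -[X in _ --> X]add0r; exact: cvgD rem vqp.
Qed.

Lemma C1_continuous X V g : C1 X V g -> {within X, continuous g}.
Proof.
move=> [gP _]; apply/subspace_continuousP => p Xp.
by have [v /is_gradient_cvg] := gP p Xp.
Qed.

Lemma C1_continuous_dt X V g : C1 X V g ->
  {within X, continuous (fun p => (gradient X V g p).1)}.
Proof.
move=> [_ cg]; apply: (within_continuous_compr cg) => q; exact: cvg_fst.
Qed.

Lemma C1_continuous_grad X V g i : C1 X V g ->
  {within X, continuous (fun p => (gradient X V g p).2 0 i)}.
Proof.
move=> [_ cg].
apply: (@within_continuous_compr _ _ _ X _ (fun q : R * E => q.2 0 i) cg) => q.
apply: (@continuous_comp _ _ _ snd (fun u : E => u 0 i)); first exact: cvg_snd.
exact: coord_continuous.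
Qed.

Lemma compact_QOm (Om : set E) : bounded_set Om -> compact (QOm Om).
Proof.
move=> bOm; apply: compact_setX; first exact: segment_compact.
apply: bounded_closed_compact; last exact: closed_closure.
have [M [Mr MOm]] := bOm; exists (M + 1); split; first exact: realD.
move=> x Mx y; have /closure_id -> : closed [set z : E | `|z| <= x].
  apply: (preimage_closed _ (@closed_le _ x)) => z _; exact: norm_continuous.
apply: closureS => z /MOm; apply.
by rewrite (lt_trans _ Mx)// ltrDl.
Qed.

Lemma compact_QGa (Om : set E) : bounded_set Om -> compact (QGa Om).
Proof.
move=> /compact_QOm cQ; apply: (subclosed_compact _ cQ) => [|p [? []]//].
have -> : QGa Om =
    fst @^-1` `[0, 1] `&` snd @^-1` (closure Om `&` ~` interior Om) by [].
apply: closedI; apply: preimage_closed.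
- by move=> q _; exact: cvg_fst.
- exact: interval_closed.
- by move=> q _; exact: cvg_snd.
- apply: closedI; first exact: closed_closure.
  by apply: open_closedC; exact: open_interior.
Qed.

End C1.

(** * Young inequality for the action density *)

Section young.
Context (R : realType) (d : nat).
Local Notation E := 'rV[R]_d.
Implicit Types (b F : E) (a c w f k : R).

Lemma dotZr (u v : E) t : dot u (t *: v) = t * dot u v.
Proof.
by rewrite /dot mulr_sumr; apply: eq_bigr => i _; rewrite mxE mulrCA.
Qed.

Lemma normsqZ t (v : E) : normsq (t *: v) = t ^+ 2 * normsq v.
Proof.
rewrite /normsq /dot mulr_sumr; apply: eq_bigr => i _.
by rewrite mxE; ring.
Qed.

Lemma normsq_ge0 (v : E) : 0 <= normsq v.
Proof. by apply: sumr_ge0 => i _; rewrite -expr2 sqr_ge0. Qed.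

Lemma normsqBZ (u v : E) t :
  normsq (u - t *: v) = normsq u - 2 * t * dot v u + t ^+ 2 * normsq v.
Proof.
rewrite /normsq /dot !mulr_sumr -sumrB -big_split /=.
by apply: eq_bigr => i _; rewrite !mxE; ring.
Qed.

(** The bulk action density is the boundary one without exchange flux, so that
    one inequality treats both. *)
Lemma A_Om_A_Ga w F : A_Om w F = A_Ga 1 w F 0.
Proof. by rewrite /A_Om /A_Ga expr0n /= mulr0 addr0 eqxx andbT. Qed.

Lemma A_Ga_ge0 k w F f : (0 <= A_Ga k w F f)%E.
Proof.
rewrite /A_Ga; case: ltP => [w0|_]; last by case: ifP.
rewrite lee_fin divr_ge0//; last by rewrite mulr_ge0// ltW.
by rewrite addr_ge0 ?normsq_ge0// -exprMn sqr_ge0.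
Qed.

(** The left-hand side of the Hamilton-Jacobi inequality, with a the time
    derivative, b the gradient and c the jump between boundary and bulk. *)
Definition HJ_residual k a b c : R :=
  a + 2^-1 * normsq b + (2 * k ^+ 2)^-1 * `|c| ^+ 2.

Lemma HJ_residual0 k a b : HJ_residual k a b 0 = a + 2^-1 * normsq b.
Proof. by rewrite /HJ_residual normr0 expr0n mulr0 addr0. Qed.

(** For w > 0, twice w times the difference of the two sides is at least
    |F - w b|^2 + (k f - w c / k)^2. *)
Lemma pairing_le_A_Ga k a b c w F f : 0 < k -> HJ_residual k a b c <= 0 ->
  ((a * w + dot b F + c * f)%:E <= A_Ga k w F f)%E.
Proof.
rewrite /HJ_residual real_normK ?num_real// => k0 abc.
rewrite /A_Ga; case: ltP => [w0|_]; last first.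
  case: ifP => [/and3P[/eqP-> /eqP-> /eqP->]|_]; last by rewrite leey.
  by rewrite !mulr0 add0r addr0 lee_fin -(scale0r 0) dotZr mul0r.
rewrite lee_fin ler_pdivlMr ?mulr_gt0//.
have := normsq_ge0 (F - w *: b); rewrite normsqBZ => sqF.
(* the rescaling e = c / k makes the inequality polynomial *)
have [e ce] : exists e, c = k * e by exists (k^-1 * c); rewrite mulVKf ?gt_eqF.
have {}abc : a <= - (2^-1 * normsq b + 2^-1 * e ^+ 2).
  have kE : (2 * k ^+ 2)^-1 * c ^+ 2 = 2^-1 * e ^+ 2.
    by rewrite ce; field; rewrite gt_eqF.
  by rewrite kE in abc; lra.
have := sqr_ge0 (k * f - w * e) => sqf.
have /(ler_wpM2l (sqr_ge0 w)) := abc.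
by rewrite ce; nra.
Qed.

(** The equality case; finiteness of the action density rules out w < 0. *)
Lemma pairing_eq_A_Ga k a b c w F f : 0 < k ->
  HJ_residual k a b c = 0 \/ w = 0 ->
  F = w *: b -> f = c / k ^+ 2 * w ->
  A_Ga k w F f != +oo%E ->
  A_Ga k w F f = (a * w + dot b F + c * f)%:E.
Proof.
rewrite /HJ_residual real_normK ?num_real// => k0 abc -> ->.
rewrite /A_Ga; case: ltP => [w0 _|_]; last first.
  case: ifP => [/and3P[/eqP-> _ _] _|_]; last by rewrite eqxx.
  by rewrite dotZr !(mulr0, mul0r) !addr0.
case: abc => [abc|w_eq0]; last by rewrite w_eq0 ltxx in w0.
have -> : a = - (2^-1 * normsq b + (2 * k ^+ 2)^-1 * c ^+ 2) by lra.
rewrite normsqZ dotZr -/(normsq b); congr EFin.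
by field; rewrite !gt_eqF.
Qed.

End young.

(** * Integrated Young inequality *)

Section pairing.
Context (dd : measure_display) (T : measurableType dd) (R : realType) (d : nat).
Local Notation E := 'rV[R]_d.
Variables (lam : {measure set T -> \bar R}) (D : set T) (mD : measurable D).
Variables (k : R) (k0 : 0 < k) (a : T -> R) (b : T -> E) (c : T -> R).
Variables (w : T -> R) (F : T -> E) (f : T -> R).
Hypotheses (mw : measurable_fun D w).
Hypotheses (mF : forall i, measurable_fun D (fun x => F x 0 i)).
Hypotheses (mf : measurable_fun D f).

Let h x := a x * w x + dot (b x) (F x) + c x * f x.

Hypothesis ih : lam.-integrable D (EFin \o h).

Lemma measurable_A_Ga : measurable_fun D (fun x => A_Ga k (w x) (F x) (f x)).
Proof.
(* the test F x = 0 becomes a test on a measurable real function *)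
have F0E x : (F x == 0) = (normsq (F x) == 0).
  apply/eqP/eqP => [->|/eqP].
    by rewrite /normsq /dot big1// => i _; rewrite mxE mulr0.
  rewrite psumr_eq0 => [/allP Fx0|i _]; last by rewrite -expr2 sqr_ge0.
  apply/rowP => i; rewrite mxE; apply/eqP.
  by have := Fx0 i (mem_index_enum _); rewrite /= -expr2 sqrf_eq0.
have mN : measurable_fun D (fun x => normsq (F x)).
  by rewrite /normsq /dot; apply: measurable_sum => i; exact: measurable_funM.
have mw0 : measurable_fun D (fun x => 0 < w x) by exact: measurable_fun_ltr.
rewrite /A_Ga; apply: measurable_fun_if => //.
- set Dp := D `&` _; have mDp : measurable Dp by exact: mw0.
  have sDp : Dp `<=` D by move=> x [].
  (* where w is positive, the inverse coincides with a measurable real power *)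
  apply/measurable_EFinP; apply: (eq_measurable_fun (fun x =>
      (normsq (F x) + k ^+ 2 * f x ^+ 2) * (2 * w x) `^ (-1))).
    move=> x; rewrite inE => -[_ /= w0].
    by rewrite powR_inv1// mulr_ge0// ltW.
  apply: measurable_funM.
    apply: (measurable_funS mD sDp); apply: measurable_funD => //.
    by apply: measurable_funM => //; exact: measurable_funX.
  apply: (measurableT_comp (measurable_powR (-1))).
  by apply: (measurable_funS mD sDp); exact: measurable_funM.
- set Dn := D `&` _; have mDn : measurable Dn by exact: mw0.
  apply: (@measurable_funS _ _ _ _ D) => //; first by move=> x [].
  under eq_fun do rewrite F0E.
  apply: measurable_fun_if => //.
  by apply: measurable_and; [|apply: measurable_and]; apply: measurable_fun_eqr.
Qed.

(** The action may be infinite, so the integrals are compared through the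
    positive part of h, which the nonnegative action density dominates. *)
Lemma pairing_le_action :
  (forall x, D x -> HJ_residual k (a x) (b x) (c x) <= 0) ->
  ((\int[lam]_(x in D) h x)%:E <= \int[lam]_(x in D) A_Ga k (w x) (F x) (f x))%E.
Proof.
move=> HJ; rewrite /Rintegral fineK; last exact: integrable_fin_num.
apply: (@le_trans _ _ (\int[lam]_(x in D) (EFin \o h)^\+ x)%E).
  rewrite integralE leeBlDr ?integrable_neg_fin_num//.
  by rewrite leeDl// integral_ge0.
apply: ge0_le_integral => //.
- by apply: measurable_funepos; exact: measurable_int ih.
- exact: measurable_A_Ga.
- by move=> x Dx; rewrite funeposE ge_max pairing_le_A_Ga ?A_Ga_ge0 ?HJ.
Qed.

Lemma pairing_eq_action :
  {ae lam, forall x, D x -> HJ_residual k (a x) (b x) (c x) = 0 \/ w x = 0} ->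
  {ae lam, forall x, D x -> F x = w x *: b x} ->
  {ae lam, forall x, D x -> f x = c x / k ^+ 2 * w x} ->
  (\int[lam]_(x in D) A_Ga k (w x) (F x) (f x) < +oo)%E ->
  (\int[lam]_(x in D) A_Ga k (w x) (F x) (f x) = (\int[lam]_(x in D) h x)%:E)%E.
Proof.
move=> HJ FE fE Afin; rewrite /Rintegral fineK; last exact: integrable_fin_num.
have iA : lam.-integrable D (fun x => A_Ga k (w x) (F x) (f x)).
  apply/integrableP; split; first exact: measurable_A_Ga.
  by under eq_integral do rewrite gee0_abs ?A_Ga_ge0//.
apply: ae_eq_integral => //; first exact: measurable_A_Ga.
  exact: measurable_int ih.
have Af := integrable_ae mD iA.
near=> x => Dx.
have Afx : A_Ga k (w x) (F x) (f x) \is a fin_num by move: Dx; near: x.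
apply: pairing_eq_A_Ga => //.
- by move: Dx; near: x.
- by move: Dx; near: x.
- by move: Dx; near: x.
- by move: Afx; rewrite fin_numE => /andP[].
Unshelve. all: by end_near.
Qed.

End pairing.

(** * Duality for measures *)

Section duality.
Context (dd : measure_display) (T : measurableType dd) (R : realType) (d : nat).
Local Notation E := 'rV[R]_d.
Variables (lam : {finite_measure set T -> \bar R}) (D : set T).
Hypothesis mD : measurable D.

Definition bounded_measurable (g : T -> R) :=
  measurable_fun D g /\ [bounded g x | x in D].

Lemma bounded_measurable_mulr r (g : T -> R) : bounded_measurable g ->
  bounded_measurable (fun x => g x * r).
Proof.
move=> [mg [M [Mr Mg]]]; split; first exact: measurable_funM.
exists ((`|M| + 1) * `|r|); split; first exact: num_real.
move=> x /ltW Mx y Dy; rewrite /= normrM; apply: le_trans Mx.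
by rewrite ler_wpM2r// Mg// ltr_pwDr// ler_norm.
Qed.

Lemma bounded_measurableB (g1 g2 : T -> R) :
  bounded_measurable g1 -> bounded_measurable g2 ->
  bounded_measurable (fun x => g1 x - g2 x).
Proof.
move=> [mg1 bg1] [mg2 bg2]; split; first exact: measurable_funB.
case: bg1 bg2 => [M1 [_ Mg1]] [M2 [_ Mg2]].
exists (M1 + 1 + (M2 + 1)); split; first exact: num_real.
move=> x /ltW Mx y Dy; apply: le_trans Mx; apply: le_trans (ler_normB _ _) _.
by apply: lerD; [apply: Mg1|apply: Mg2] => //; rewrite ltrDl.
Qed.

Lemma cintegralB (nu : {charge set T -> \bar R}) (g1 g2 : T -> R) :
  bounded_measurable g1 -> bounded_measurable g2 ->
  cintegral nu D (fun x => g1 x - g2 x) = cintegral nu D g1 - cintegral nu D g2.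
Proof.
move=> bm1 bm2; have [m12 b12] := bounded_measurableB bm1 bm2.
move: bm1 bm2 => [m1 b1] [m2 b2].
have nunu : nu `<< sum_variation [:: nu] by exact: sum_variation_head.
rewrite !(cintegral_density nunu)// -RintegralB//.
- by apply: eq_Rintegral => x _; rewrite mulrBl.
- exact: integrable_mul_density.
- exact: integrable_mul_density.
Qed.

Lemma Rintegral_sum (I : Type) (s : seq I) (g : I -> T -> R) :
  (forall i, lam.-integrable D (EFin \o g i)) ->
  lam.-integrable D (EFin \o (fun x => \sum_(i <- s) g i x)) /\
  \int[lam]_(x in D) (\sum_(i <- s) g i x) =
    \sum_(i <- s) \int[lam]_(x in D) g i x.
Proof.
move=> ig; elim: s => [|i s [is_ IH]].
  rewrite (_ : (fun _ => _) = cst 0); last by apply/funext => x; rewrite big_nil.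
  rewrite big_nil Rintegral_cst// mul0r; split => //; exact: integrable0.
rewrite (_ : (fun _ => _) = (fun x => g i x + \sum_(j <- s) g j x)); last first.
  by apply/funext => x; rewrite big_cons.
rewrite big_cons RintegralD// IH; split => //.
have := integrableD mD (ig i) is_; by apply: eq_integrable.
Qed.

Variables (k : R) (k0 : 0 < k).
Variables (w : {charge set T -> \bar R}) (F : 'I_d -> {charge set T -> \bar R}).
Variables (a : T -> R) (b : T -> E).
Hypotheses (wlam : w `<< lam) (Flam : forall i, F i `<< lam).
Hypotheses (bma : bounded_measurable a).
Hypotheses (bmb : forall i, bounded_measurable (fun x => b x 0 i)).

Let vdens x : E := \row_i density (F i) lam x.

Let vdens_i i : (fun x => vdens x 0 i) = density (F i) lam.
Proof. by apply/funext => x; rewrite mxE. Qed.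

Let mvdens i : measurable_fun D (fun x => vdens x 0 i).
Proof. by rewrite vdens_i; exact: measurable_density. Qed.

Let mdens : measurable_fun D (density w lam).
Proof. exact: measurable_density. Qed.

(** The product c f is any integrable function here, so that the bulk can take
    it to be zero without introducing a zero charge and its density. *)
Lemma pairing_density (c f : T -> R) :
  lam.-integrable D (EFin \o (fun x => c x * f x)) ->
  let h x := a x * density w lam x + dot (b x) (vdens x) + c x * f x in
  lam.-integrable D (EFin \o h) /\
  \int[lam]_(x in D) h x =
    cintegral w D a + \sum_i cintegral (F i) D (fun x => b x 0 i)
    + \int[lam]_(x in D) (c x * f x).
Proof.
move=> icf h; have [ma ba] := bma.
have iw := integrable_mul_density wlam mD ma ba.
have iF i := integrable_mul_density (Flam i) mD (bmb i).1 (bmb i).2.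
have [iS SE] := Rintegral_sum (index_enum _) iF.
have dotE x : dot (b x) (vdens x) = \sum_i b x 0 i * density (F i) lam x.
  by apply: eq_bigr => i _; rewrite mxE.
have hE : h = (fun x => a x * density w lam x
    + \sum_i b x 0 i * density (F i) lam x + c x * f x).
  by apply/funext => x; rewrite /h dotE.
have iwS : lam.-integrable D (EFin \o (fun x => a x * density w lam x
    + \sum_i b x 0 i * density (F i) lam x)).
  by have := integrableD mD iw iS; apply: eq_integrable.
rewrite hE; split; first by have := integrableD mD iwS icf; apply: eq_integrable.
rewrite RintegralD// RintegralD// SE -cintegral_density//.
by congr (_ + _ + _); apply: eq_bigr => i _; have [? ?] := bmb i;
  rewrite -cintegral_density.
Qed.

Lemma density_vector_of_has_density :
  (forall i, has_density w D (fun x => b x 0 i) (F i)) ->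
  {ae lam, forall x, D x -> vdens x = density w lam x *: b x}.
Proof.
move=> Fw; have Fi i : \forall x \ae lam,
    D x -> density (F i) lam x = b x 0 i * density w lam x.
  by have [? ?] := bmb i; exact: density_of_has_density (Fw i).
apply: filterS (@filter_forall _ _ _ (almost_everywhere lam) _ Fi) => x Fx Dx.
by apply/rowP => i; rewrite !mxE Fx// mulrC.
Qed.

(** The bulk corresponds to zero jump and zero exchange flux.
    The product 0 * 0 gives the integrand the shape used in the integrated Young
    inequality. *)
Section bulk.

Let h x := a x * density w lam x + dot (b x) (vdens x) + 0 * 0.

Let m0 : measurable_fun D (fun=> 0 : R).
Proof. exact: measurable_cst. Qed.

Let ih : lam.-integrable D (EFin \o h) /\
  \int[lam]_(x in D) h x =
    cintegral w D a + \sum_i cintegral (F i) D (fun x => b x 0 i).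
Proof.
have i0 : lam.-integrable D (EFin \o (fun=> 0 * 0)).
  apply: eq_integrable (@integrable0 _ _ _ lam D) => //.
    by move=> x _; rewrite /= mulr0.
have [? ->] := pairing_density i0; split => //.
by rewrite Rintegral_cst// !mul0r addr0.
Qed.

Lemma bulk_duality_le :
  (forall x, D x -> a x + 2^-1 * normsq (b x) <= 0) ->
  ((cintegral w D a + \sum_i cintegral (F i) D (fun x => b x 0 i))%:E <=
   \int[lam]_(x in D) A_Om (density w lam x) (vdens x))%E.
Proof.
move=> HJ; rewrite -ih.2; have {}HJ x : D x -> HJ_residual 1 (a x) (b x) 0 <= 0.
  by move=> /HJ; rewrite HJ_residual0.
under [leRHS]eq_integral do rewrite A_Om_A_Ga.
exact: (pairing_le_action (c := fun=> 0) (f := fun=> 0) mD ltr01 mdens mvdens m0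
  ih.1 HJ).
Qed.

Lemma bulk_duality_eq :
  {ae tvariation w, forall x, D x -> a x + 2^-1 * normsq (b x) = 0} ->
  (forall i, has_density w D (fun x => b x 0 i) (F i)) ->
  (\int[lam]_(x in D) A_Om (density w lam x) (vdens x) < +oo)%E ->
  (\int[lam]_(x in D) A_Om (density w lam x) (vdens x) =
  (cintegral w D a + \sum_i cintegral (F i) D (fun x => b x 0 i))%:E)%E.
Proof.
move=> HJ Fw; under eq_integral do rewrite A_Om_A_Ga; rewrite -ih.2 => Afin.
apply: (pairing_eq_action (c := fun=> 0) (f := fun=> 0) mD ltr01 mdens mvdens m0
  ih.1) => //.
- have := density_variation_ae wlam HJ; apply: filterS => x + Dx.
  by move=> [/(_ Dx)|]; [left; rewrite HJ_residual0|right].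
- exact: density_vector_of_has_density.
- by apply: nearW => x _; rewrite !mul0r.
Qed.

End bulk.

Section boundary.
Variables (f : {charge set T -> \bar R}) (c : T -> R).
Hypotheses (flam : f `<< lam) (bmc : bounded_measurable c).

Let mf : measurable_fun D (density f lam).
Proof. exact: measurable_density. Qed.

Let h x := a x * density w lam x + dot (b x) (vdens x) + c x * density f lam x.

Let ih : lam.-integrable D (EFin \o h) /\
  \int[lam]_(x in D) h x =
    cintegral w D a + \sum_i cintegral (F i) D (fun x => b x 0 i)
    + cintegral f D c.
Proof.
have [mc bc] := bmc; rewrite (cintegral_density flam)//.
exact/pairing_density/integrable_mul_density.
Qed.

Lemma boundary_duality_le :
  (forall x, D x -> HJ_residual k (a x) (b x) (c x) <= 0) ->
  ((cintegral w D a + \sum_i cintegral (F i) D (fun x => b x 0 i)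
    + cintegral f D c)%:E <=
   \int[lam]_(x in D) A_Ga k (density w lam x) (vdens x) (density f lam x))%E.
Proof.
move=> HJ; rewrite -ih.2.
exact: (pairing_le_action mD k0 mdens mvdens mf ih.1 HJ).
Qed.

Lemma boundary_duality_eq :
  {ae tvariation w, forall x, D x -> HJ_residual k (a x) (b x) (c x) = 0} ->
  (forall i, has_density w D (fun x => b x 0 i) (F i)) ->
  has_density w D (fun x => c x / k ^+ 2) f ->
  (\int[lam]_(x in D)
     A_Ga k (density w lam x) (vdens x) (density f lam x) < +oo)%E ->
  (\int[lam]_(x in D) A_Ga k (density w lam x) (vdens x) (density f lam x) =
  (cintegral w D a + \sum_i cintegral (F i) D (fun x => b x 0 i)
    + cintegral f D c)%:E)%E.
Proof.
move=> HJ Fw fw Afin; rewrite -ih.2.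
apply: (pairing_eq_action mD k0 mdens mvdens mf ih.1) => //.
- have := density_variation_ae wlam HJ; apply: filterS => x + Dx.
  by move=> [/(_ Dx)|]; [left|right].
- exact: density_vector_of_has_density.
- have [mck bck] := bounded_measurable_mulr (k ^+ 2)^-1 bmc.
  exact: density_of_has_density.
Qed.

End boundary.
End duality.

(** * Duality for the continuity equations *)

Section continuity_equation.
Context (R : realType) (d : nat).
Local Notation E := 'rV[R]_d.
Variables (Om : set E) (bOm : bounded_set Om).

Let cQO : compact (QOm Om). Proof. exact: compact_QOm. Qed.
Let cQG : compact (QGa Om). Proof. exact: compact_QGa. Qed.

Lemma compact_measurable_borel (X : set (R * E)) :
  compact X -> measurable (X : set (borel (R * E)%type)).
Proof.
move=> cX; apply: (@closed_measurable_borel _ (R * E)%type).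
exact: compact_closed (@norm_hausdorff _ _) cX.
Qed.

Lemma continuous_bounded_measurable (X : set (R * E)) (g : R * E -> R) :
  compact X -> {within X, continuous g} ->
  bounded_measurable (X : set (borel (R * E)%type)) g.
Proof.
move=> cX cg; split; last exact: within_continuous_bounded.
apply: (@within_continuous_measurable _ (R * E)%type) => //.
exact: compact_closed (@norm_hausdorff _ _) cX.
Qed.

Variables (phi psi : R * E -> R) (hphi : C1_Om Om phi) (hpsi : C1_Ga Om psi).

Let bm_dtO : bounded_measurable (QOm Om : set (borel (R * E)%type)) (dt_Om Om phi).
Proof. exact: (continuous_bounded_measurable cQO (C1_continuous_dt hphi)). Qed.

Let bm_gradO i : bounded_measurable (QOm Om : set (borel (R * E)%type))
  (fun p => grad_Om Om phi p 0 i).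
Proof.
apply: (@continuous_bounded_measurable _ (fun p => grad_Om Om phi p 0 i)) => //.
exact: (C1_continuous_grad hphi).
Qed.

Let bm_dtG : bounded_measurable (QGa Om : set (borel (R * E)%type)) (dt_Ga Om psi).
Proof. exact: (continuous_bounded_measurable cQG (C1_continuous_dt hpsi)). Qed.

Let bm_gradG i : bounded_measurable (QGa Om : set (borel (R * E)%type))
  (fun p => grad_Ga Om psi p 0 i).
Proof.
apply: (@continuous_bounded_measurable _ (fun p => grad_Ga Om psi p 0 i)) => //.
exact: (C1_continuous_grad hpsi).
Qed.

Let bm_psi : bounded_measurable (QGa Om : set (borel (R * E)%type)) psi.
Proof. exact: (continuous_bounded_measurable cQG (C1_continuous hpsi)). Qed.

Let bm_phi : bounded_measurable (QGa Om : set (borel (R * E)%type)) phi.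
Proof.
apply: (continuous_bounded_measurable cQG).
apply: continuous_subspaceW (C1_continuous hphi).
by move=> p [? []].
Qed.

Let mQO := compact_measurable_borel cQO.
Let mQG := compact_measurable_borel cQG.

Let bm_jump : bounded_measurable (QGa Om : set (borel (R * E)%type))
  (fun p => psi p - phi p).
Proof. exact: bounded_measurableB. Qed.

Local Notation smeasure := {finite_measure set borel E -> \bar R}.
Variables (rho0 rho1 : smeasure * smeasure) (kappa : R) (kappa_gt0 : 0 < kappa).

Definition dual_value : R :=
  \int[rho1.1]_(x in closure Om) phi (1, x)
    - \int[rho0.1]_(x in closure Om) phi (0, x)
  + (\int[rho1.2]_(x in bdry Om) psi (1, x)
    - \int[rho0.2]_(x in bdry Om) psi (0, x)).

(** The dual value depends only on the endpoints rho0 and rho1, so the pairing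
    with the derivatives of phi and psi is the same for all competitors. *)
Lemma CE_dual_value mu : CE Om rho0 rho1 mu ->
  dual_value =
    (cintegral (omega_ mu) (QOm Om) (dt_Om Om phi)
     + \sum_i cintegral (F_ mu i) (QOm Om) (fun p => grad_Om Om phi p 0 i))
  + (cintegral (gamma_ mu) (QGa Om) (dt_Ga Om psi)
     + \sum_i cintegral (G_ mu i) (QGa Om) (fun p => grad_Ga Om psi p 0 i)
     + cintegral (f_ mu) (QGa Om) (fun p => psi p - phi p)).
Proof.
move=> [_ /(_ _ hphi) CEphi /(_ _ hpsi) CEpsi].
by rewrite /dual_value -CEphi -CEpsi (cintegralB mQG)//; ring.
Qed.

Lemma dual_value_le_action mu : CE Om rho0 rho1 mu ->
  (forall p, QOm Om p ->
     dt_Om Om phi p + 2^-1 * normsq (grad_Om Om phi p) <= 0) ->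
  (forall p, QGa Om p ->
     dt_Ga Om psi p + 2^-1 * normsq (grad_Ga Om psi p)
       + (2 * kappa ^+ 2)^-1 * `|psi p - phi p| ^+ 2 <= 0) ->
  (dual_value%:E <= kinetic_action Om kappa mu)%E.
Proof.
move=> /CE_dual_value-> HJO HJG; rewrite EFinD; apply: leeD.
- apply: bulk_duality_le => //.
  + exact: sum_variation_head.
  + by move=> i; apply: sum_variation_behead; exact: sum_variation_codom.
- apply: boundary_duality_le => //.
  + exact: sum_variation_head.
  + by move=> i; do 2!apply: sum_variation_behead; exact: sum_variation_codom.
  + by apply: sum_variation_behead; exact: sum_variation_head.
Qed.

Lemma dual_value_eq_action mu : CE Om rho0 rho1 mu ->
  (kinetic_action Om kappa mu < +oo)%E ->
  (forall i, has_density (omega_ mu) (QOm Om)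
     (fun p => grad_Om Om phi p 0 i) (F_ mu i)) ->
  (forall i, has_density (gamma_ mu) (QGa Om)
     (fun p => grad_Ga Om psi p 0 i) (G_ mu i)) ->
  has_density (gamma_ mu) (QGa Om)
    (fun p => (psi p - phi p) / kappa ^+ 2) (f_ mu) ->
  {ae tvariation (omega_ mu), forall p, QOm Om p ->
     dt_Om Om phi p + 2^-1 * normsq (grad_Om Om phi p) = 0} ->
  {ae tvariation (gamma_ mu), forall p, QGa Om p ->
     dt_Ga Om psi p + 2^-1 * normsq (grad_Ga Om psi p)
       + (2 * kappa ^+ 2)^-1 * `|psi p - phi p| ^+ 2 = 0} ->
  kinetic_action Om kappa mu = dual_value%:E.
Proof.
move=> /CE_dual_value-> + Fw Gg fg HJO HJG.
rewrite /kinetic_action /kinetic_action_wrt EFinD.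
set AO := (X in (X + _ < +oo)%E -> _); set AG := (X in (_ + X < +oo)%E -> _).
move=> Afin.
have AO0 : (0 <= AO)%E.
  by apply: integral_ge0 => p _; rewrite A_Om_A_Ga A_Ga_ge0.
have AG0 : (0 <= AG)%E by apply: integral_ge0 => p _; exact: A_Ga_ge0.
congr (_ + _)%E.
- apply: bulk_duality_eq => //.
  + exact: sum_variation_head.
  + by move=> i; apply: sum_variation_behead; exact: sum_variation_codom.
  + by apply: le_lt_trans Afin; rewrite leeDl.
- apply: boundary_duality_eq => //.
  + exact: sum_variation_head.
  + by move=> i; do 2!apply: sum_variation_behead; exact: sum_variation_codom.
  + by apply: sum_variation_behead; exact: sum_variation_head.
  + by apply: le_lt_trans Afin; rewrite leeDr.
Qed.

End continuity_equation.

Theorem theorem3 (R : realType) (d : nat) (d_gt0 : (0 < d)%N)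
  (Om : set 'rV[R]_d) (hOm : smooth_bounded_domain Om)
  (kappa : R) (kappa_gt0 : 0 < kappa)
  (rho0 rho1 : {finite_measure set borel 'rV[R]_d -> \bar R} *
               {finite_measure set borel 'rV[R]_d -> \bar R})
  (hrho0 : P_oplus Om rho0) (hrho1 : P_oplus Om rho1)
  (mu : flux R d) (hmu : CE Om rho0 rho1 mu)
  (hfin : (kinetic_action Om kappa mu < +oo)%E)
  (phi psi : R * 'rV[R]_d -> R)
  (hphi : C1_Om Om phi) (hpsi : C1_Ga Om psi)
  (hF : forall i, has_density (omega_ mu) (QOm Om)
          (fun p => grad_Om Om phi p 0 i) (F_ mu i))
  (hG : forall i, has_density (gamma_ mu) (QGa Om)
          (fun p => grad_Ga Om psi p 0 i) (G_ mu i))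
  (hf : has_density (gamma_ mu) (QGa Om)
          (fun p => (psi p - phi p) / kappa ^+ 2) (f_ mu))
  (hHJ_Om : forall p, QOm Om p ->
     dt_Om Om phi p + 2^-1 * normsq (grad_Om Om phi p) <= 0)
  (hHJ_Om_ae : {ae tvariation (omega_ mu), forall p, QOm Om p ->
     dt_Om Om phi p + 2^-1 * normsq (grad_Om Om phi p) = 0})
  (hHJ_Ga : forall p, QGa Om p ->
     dt_Ga Om psi p + 2^-1 * normsq (grad_Ga Om psi p)
       + (2 * kappa ^+ 2)^-1 * `|psi p - phi p| ^+ 2 <= 0)
  (hHJ_Ga_ae : {ae tvariation (gamma_ mu), forall p, QGa Om p ->
     dt_Ga Om psi p + 2^-1 * normsq (grad_Ga Om psi p)
       + (2 * kappa ^+ 2)^-1 * `|psi p - phi p| ^+ 2 = 0}) :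
  W2 Om kappa rho0 rho1 = kinetic_action Om kappa mu.
Proof.
have [_ _ _ bOm _] := hOm.
apply/eqP; rewrite eq_le; apply/andP; split.
  by apply: ereal_inf_lbound; exists mu.
apply/ereal_infP => _ [nu nuCE <-].
rewrite (dual_value_eq_action bOm hphi hpsi kappa_gt0 hmu)//.
exact: dual_value_le_action.
Qed.
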